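(* Let $n\geqslant 3$. Let $R_\mathrm{s}$ be the set of relations on the alphabet $\{a_0,b_0,e_0,f_0,d,z\}$ consisting of all relations of $R_0$ together with $$d^2=d,\quad a_0d=da_0,\quad b_0d=db_0,\quad e_0d=de_0,\quad f_0d=df_0,$$ $$a_0z=z,\quad b_0z=z,\quad e_0z=z,\quad dz=zf_0,\quad zd=(f_0b_0)^{n-1}z,\quad z^2=(e_0b_0)^{n-3}e_0,\quad d(f_0b_0)^{n-1}z=d(f_0b_0)^{n-1}.$$ Then the presentation $\langle a_0,b_0,e_0,f_0,d,z\mid R_\mathrm{s}\rangle$ defines the monoid $\mathrm{PsEnd}(S_n)$ of all partial strong endomorphisms of the star graph $S_n$.
   Context: Let $\Omega_{n-1}=\{1,\ldots,n-1\}$ and $\Omega_{n-1}^0=\{0,1,\ldots,n-1\}$. $\mathcal{PT}(\Omega)$ is the monoid of all partial transformations of $\Omega$; maps are written on the right and composed from left to right. $S_n$ is the star graph with vertex set $\Omega_{n-1}^0$ and edge set $\{\{0,i\}\mid 1\leqslant i\leqslant n-1\}$. For a simple graph $G=(V,E)$, $\alpha\in\mathcal{PT}(V)$ is a partial strong endomorphism if, for all $u,v\in\mathrm{Dom}(\alpha)$, $\{u,v\}\in E$ if and only if $\{u\alpha,v\alpha\}\in E$; $\mathrm{PsEnd}(G)$ is the submonoid of $\mathcal{PT}(V)$ of all these. The letters stand for the following generators of $\mathrm{PsEnd}(S_n)$, elements of $\mathcal{PT}(\Omega_{n-1}^0)$: $a_0$ is the permutation swapping $1$ and $2$ and fixing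 all else; $b_0$ is the permutation with $0\mapsto 0$, $i\mapsto i+1$ for $1\leqslant i\leqslant n-2$, $n-1\mapsto 1$; $e_0$ is the full transformation with $2\mapsto 1$ fixing all else; $f_0$ is the partial identity with domain $\Omega_{n-1}^0\setminus\{1\}$; $d$ is the partial identity with domain $\Omega_{n-1}$; $z$ is the full transformation with $0\mapsto 1$ and $i\mapsto 0$ for $1\leqslant i\leqslant n-1$. $R_0$ is any fixed set of relations on the alphabet $\{a_0,b_0,e_0,f_0\}$ which defines, on the generators $a_0,b_0,e_0,f_0$, the monoid $\{\alpha\in\mathcal{PT}(\Omega_{n-1}^0)\mid 0\in\mathrm{Dom}(\alpha),\ 0\alpha=0,\ \Omega_{n-1}\alpha\subseteq\Omega_{n-1}\}$ (isomorphic to $\mathcal{PT}(\Omega_{n-1})$); that is, two words over $\{a_0,b_0,e_0,f_0\}$ are congruent modulo $R_0$ if and only if they represent the same transformation. For an alphabet $X$, $X^*$ is the free monoid on $X$; a relation $u=v$ is a pair $(u,v)\in X^*\times X^*$; $\sim_R$ is the congruence on $X^*$ generated by $R$. A monoid $M$ is defined by the presentation $\langle X\mid R\rangle$ if $M\cong X^*/{\sim_R}$. *)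

(* Defs.v *)
From HB Require Import structures.
From mathcomp Require Import all_boot.
From mathcomp Require Import boolp.

Set Implicit Arguments.
Unset Strict Implicit.
Unset Printing Implicit Defensive.

Local Open Scope group_scope.
Local Open Scope quotient_scope.

Definition word (X : Type) := seq X.

HB.instance Definition _ (X : choiceType) := Choice.on (word X).
HB.instance Definition _ (X : choiceType) :=
  isMonoid.Build (word X) (@catA X) (@cat0s X) (@cats0 X).

Definition letter_word (X : Type) (x : X) : word X := [:: x].

Definition map_word (X Y : Type) (f : X -> Y) (w : word X) : word Y := map f w.

Definition eval_word (X : choiceType) (M : monoidType) (g : X -> M)
    (w : word X) : M :=
  \prod_(x <- w) g x.

Section Presentation.
Variables (X : choiceType) (R : word X -> word X -> Prop).

Inductive congruent : word X -> word X -> Prop :=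
| congruent_rel u v of R u v : congruent u v
| congruent_refl u : congruent u u
| congruent_sym u v of congruent u v : congruent v u
| congruent_trans u v w of congruent u v & congruent v w : congruent u w
| congruent_mul u u' v v' of congruent u u' & congruent v v' :
    congruent (u * v) (u' * v').

Definition congruentb (u v : word X) : bool := `[< congruent u v >].

Lemma congruentb_refl : reflexive congruentb.
Proof. by move=> u; apply/asboolP; constructor. Qed.

Lemma congruentb_sym : symmetric congruentb.
Proof. by move=> u v; apply/asboolP/asboolP; apply: congruent_sym. Qed.

Lemma congruentb_trans : transitive congruentb.
Proof.
move=> v u w /asboolP uv /asboolP vw; apply/asboolP.
exact: congruent_trans uv vw.
Qed.

Definition congruent_equiv :=
  EquivRel congruentb congruentb_refl congruentb_sym congruentb_trans.

(* The quotient monoid X^* / ~_R. *)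
Definition presented := {eq_quot congruent_equiv}.

HB.instance Definition _ := Choice.on presented.

Definition word_class (w : word X) : presented := \pi_(presented) w.

Definition presented_one : presented := word_class 1.
Definition presented_mul (p q : presented) : presented :=
  word_class (repr p * repr q).

Lemma word_classP u v : word_class u = word_class v <-> congruent u v.
Proof.
split=> [/eqmodP /asboolP //|uv].
by apply/eqmodP/asboolP.
Qed.

Lemma congruent_repr w : congruent (repr (word_class w)) w.
Proof. by apply/word_classP; rewrite /word_class reprK. Qed.

Lemma word_class_repr p : word_class (repr p) = p.
Proof. exact: reprK. Qed.

Lemma word_classM u v :
  word_class (u * v) = presented_mul (word_class u) (word_class v).
Proof.
by apply/word_classP/congruent_sym/congruent_mul; apply: congruent_repr.
Qed.

Lemma presented_mulA : associative presented_mul.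
Proof.
move=> p q r; rewrite -(word_class_repr p) -(word_class_repr q).
by rewrite -(word_class_repr r) -!word_classM mulgA.
Qed.

Lemma presented_mul1 : left_id presented_one presented_mul.
Proof. by move=> p; rewrite -(word_class_repr p) -word_classM mul1g. Qed.

Lemma presented_mulr1 : right_id presented_one presented_mul.
Proof. by move=> p; rewrite -(word_class_repr p) -word_classM mulg1. Qed.

HB.instance Definition _ :=
  isMonoid.Build presented presented_mulA presented_mul1 presented_mulr1.

(* <X | R> defines M, the letter x standing for the element g x of M. *)
Definition presentation_defines (M : monoidType) (g : X -> M) : Prop :=
  exists f : presented -> M,
    [/\ monoid_morphism f, bijective f &
        forall x, f (word_class (letter_word x)) = g x].

End Presentation.

(* [a x = None] when x is not in the domain of a. *)
Definition ptransf (V : finType) := {ffun V -> option V}.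

HB.instance Definition _ (V : finType) := Finite.on (ptransf V).

Section PartialTransformations.
Variable V : finType.

Definition ptransf_one : ptransf V := [ffun x => Some x].

(* Composition from left to right: x (a b) = (x a) b. *)
Definition ptransf_mul (a b : ptransf V) : ptransf V :=
  [ffun x => obind b (a x)].

Lemma ptransf_mulA : associative ptransf_mul.
Proof.
move=> a b c; apply/ffunP=> x; rewrite !ffunE.
by case: (a x) => //= y; rewrite ffunE.
Qed.

Lemma ptransf_mul1 : left_id ptransf_one ptransf_mul.
Proof. by move=> a; apply/ffunP=> x; rewrite !ffunE. Qed.

Lemma ptransf_mulr1 : right_id ptransf_one ptransf_mul.
Proof.
move=> a; apply/ffunP=> x; rewrite !ffunE.
by case: (a x) => //= y; rewrite ffunE.
Qed.

HB.instance Definition _ :=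
  isMonoid.Build (ptransf V) ptransf_mulA ptransf_mul1 ptransf_mulr1.

End PartialTransformations.

Record sgraph (V : finType) := SGraph {
  edges : {set {set V}};
  card_edge : forall e, e \in edges -> #|e| = 2
}.

Section PsEnd.
Variables (V : finType) (G : sgraph V).

Definition is_psend : {pred ptransf V} := fun a =>
  [forall u, forall v,
    if (a u, a v) is (Some u', Some v')
    then ([set u; v] \in edges G) == ([set u'; v'] \in edges G) else true].

Lemma is_psend_closed : monoid_closed is_psend.
Proof.
split=> [|a b /forallP aP /forallP bP].
  by apply/forallP=> u; apply/forallP=> v; rewrite !ffunE eqxx.
apply/forallP=> u; apply/forallP=> v; rewrite !ffunE.
have := forallP (aP u) v.
case: (a u) (a v) => [u'|] [v'|] //=; last by case: (b u').
by move=> /eqP ->; exact: (forallP (bP u') v').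
Qed.

Record psEnd := PsEnd {psend_val : ptransf V; _ : is_psend psend_val}.

HB.instance Definition _ := [isSub for psend_val].
HB.instance Definition _ := [Finite of psEnd by <:].
HB.instance Definition _ :=
  SubChoice_isSubMonoid.Build (ptransf V) is_psend psEnd is_psend_closed.

End PsEnd.

Section Star.
Local Open Scope nat_scope.
Variable n : nat.

Definition star_edges : {set {set 'I_n}} :=
  [set [set i; j] | i in [pred i : 'I_n | i == 0 :> nat],
                    j in [pred j : 'I_n | 0 < j]].

Lemma card_star_edge e : e \in star_edges -> #|e| = 2.
Proof.
move=> /imset2P[i j]; rewrite !inE => /eqP i0 j0 ->.
by rewrite cards2 -val_eqE /= i0 eq_sym -lt0n j0.
Qed.

Definition star : sgraph 'I_n := SGraph card_star_edge.

(* Values outside {0, ..., n-1} are discarded; for n >= 3 the functions below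
   never produce one. *)
Definition ptransf_of (f : nat -> option nat) : ptransf 'I_n :=
  [ffun i : 'I_n => obind (fun k => insub k : option 'I_n) (f i)].

Definition tr_a0 := ptransf_of (fun i =>
  Some (if i == 1 then 2 else if i == 2 then 1 else i)).
Definition tr_b0 := ptransf_of (fun i =>
  Some (if i == 0 then 0 else if i == n.-1 then 1 else i.+1)).
Definition tr_e0 := ptransf_of (fun i => Some (if i == 2 then 1 else i)).
Definition tr_f0 := ptransf_of (fun i => if i == 1 then None else Some i).
Definition tr_d := ptransf_of (fun i => if i == 0 then None else Some i).
Definition tr_z := ptransf_of (fun i => Some (if i == 0 then 1 else 0)).

End Star.

Inductive letter0 := La0 | Lb0 | Le0 | Lf0.
Inductive letter := L0 of letter0 | Ld | Lz.

HB.instance Definition _ := gen_eqMixin letter0.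
HB.instance Definition _ := gen_choiceMixin letter0.
HB.instance Definition _ := gen_eqMixin letter.
HB.instance Definition _ := gen_choiceMixin letter.

Definition generator0 (n : nat) (x : letter0) : ptransf 'I_n :=
  match x with
  | La0 => tr_a0 n | Lb0 => tr_b0 n | Le0 => tr_e0 n | Lf0 => tr_f0 n
  end.

Definition generator (n : nat) (x : letter) : ptransf 'I_n :=
  match x with
  | L0 y => generator0 n y | Ld => tr_d n | Lz => tr_z n
  end.

Section Relations.
Variables (n : nat) (R0 : word letter0 -> word letter0 -> Prop).

Let a0 : word letter := letter_word (L0 La0).
Let b0 : word letter := letter_word (L0 Lb0).
Let e0 : word letter := letter_word (L0 Le0).
Let f0 : word letter := letter_word (L0 Lf0).
Let d : word letter := letter_word Ld.
Let z : word letter := letter_word Lz.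

Inductive Rs : word letter -> word letter -> Prop :=
| Rs_R0 u v of R0 u v : Rs (map_word L0 u) (map_word L0 v)
| Rs_dd : Rs (d ^+ 2) d
| Rs_a0d : Rs (a0 * d) (d * a0)
| Rs_b0d : Rs (b0 * d) (d * b0)
| Rs_e0d : Rs (e0 * d) (d * e0)
| Rs_f0d : Rs (f0 * d) (d * f0)
| Rs_a0z : Rs (a0 * z) z
| Rs_b0z : Rs (b0 * z) z
| Rs_e0z : Rs (e0 * z) z
| Rs_dz : Rs (d * z) (z * f0)
| Rs_zd : Rs (z * d) ((f0 * b0) ^+ (n - 1)%N * z)
| Rs_zz : Rs (z ^+ 2) ((e0 * b0) ^+ (n - 3)%N * e0)
| Rs_dfbz : Rs (d * (f0 * b0) ^+ (n - 1)%N * z) (d * (f0 * b0) ^+ (n - 1)%N).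

End Relations.

(* Main.v *)
Require Import Defs.
From mathcomp Require Import all_boot all_fingroup.

(* The relations of R_0 hold exactly when the transformations agree, and a_0,
   b_0, e_0, f_0 generate all partial transformations fixing 0 and preserving
   {1, ..., n-1}; hence alpha |-> (class of any word for alpha) is a
   monoid morphism iota (tr_class below) from PT({1, ..., n-1}) to the
   presented monoid Q.
   Let c be the constant 1 on {1, ..., n-1}. In Q one gets
   iota(c) z = z = z iota(c), so that z iota(f) depends only on the value 1f
   and iota(f) z only on the domain of f; moreover z iota(f) = d z when 1f is
   undefined. It follows that each element of Q is one of
     iota(f),  d iota(f),  iota(f) z iota(const_y),  d iota(f) z,
   and that it can be recomputed from the partial transformation it
   represents. As every partial strong endomorphism of the star has one of
   these four shapes, evaluation is a bijection. *)

Set Implicit Arguments.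
Unset Strict Implicit.
Unset Printing Implicit Defensive.

Local Open Scope group_scope.

(** * Evaluation of words and the quotient monoid *)

Section Words.
Variable X : choiceType.

Lemma eval_word1 (M : monoidType) (g : X -> M) : eval_word g 1 = 1.
Proof. exact: big_nil. Qed.

Lemma eval_wordM (M : monoidType) (g : X -> M) :
  {morph eval_word g : u v / u * v}.
Proof. by move=> u v; rewrite /eval_word big_cat. Qed.

Lemma eval_letter (M : monoidType) (g : X -> M) x :
  eval_word g (letter_word x) = g x.
Proof. by rewrite /eval_word big_seq1. Qed.

Lemma eval_wordX (M : monoidType) (g : X -> M) u k :
  eval_word g (u ^+ k) = eval_word g u ^+ k.
Proof.
by elim: k => [|k IHk]; rewrite ?eval_word1 // !expgS eval_wordM IHk.
Qed.

Lemma eval_word_morph (M N : monoidType) (f : M -> N) (g : X -> M)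
    (h : X -> N) :
  monoid_morphism f -> (forall x, f (g x) = h x) ->
  forall u, f (eval_word g u) = eval_word h u.
Proof.
move=> [f1 fM] fg u; rewrite /eval_word (big_morph f fM f1).
by apply: eq_bigr => x _; exact: fg.
Qed.

Lemma eval_word_map (Y : choiceType) (M : monoidType) (f : Y -> X)
    (g : X -> M) u :
  eval_word g (map_word f u) = eval_word (g \o f) u.
Proof. exact: big_map. Qed.

Lemma word_classX (R : word X -> word X -> Prop) u k :
  word_class R (u ^+ k) = word_class R u ^+ k.
Proof. by elim: k => // k IHk; rewrite !expgS word_classM IHk. Qed.

Lemma presented_ind (R : word X -> word X -> Prop) (P : presented R -> Prop) :
  P 1 -> (forall q x, P q -> P (q * word_class R (letter_word x))) ->
  forall q, P q.
Proof.
move=> P1 PM q; rewrite -(word_class_repr q).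
elim/last_ind: (generic_quotient.repr q) => [|u x IHu]; first exact: P1.
by rewrite -cats1 (word_classM _ u [:: x]); exact: PM.
Qed.

(** The universal property of the quotient: evaluation is constant along derivations, so it can be
    read off from the chosen representative of a class. *)
Lemma presented_lift (R : word X -> word X -> Prop) (M : monoidType)
    (g : X -> M) :
  (forall u v, R u v -> eval_word g u = eval_word g v) ->
  exists f : presented R -> M, monoid_morphism f /\
    forall u, f (word_class R u) = eval_word g u.
Proof.
move=> gR.
have gC u v : congruent R u v -> eval_word g u = eval_word g v.
  elim=> {u v} [u v /gR //|//|u v _ -> //|u v w _ -> _ -> //|].
  by move=> u u' v v' _ uu' _ vv'; rewrite !eval_wordM uu' vv'.
have fE u :
    eval_word g (generic_quotient.repr (word_class R u)) = eval_word g u.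
  exact/gC/congruent_repr.
exists (fun q => eval_word g (generic_quotient.repr q)); split=> //.
split=> [|p q]; first by rewrite fE eval_word1.
by rewrite -eval_wordM; exact: fE.
Qed.

End Words.

(** * Partial transformations of a finite set and their generation *)

Section Transformations.
Variable V : finType.
Implicit Types (a : ptransf V) (s t : {perm V}) (x y : V).

Definition perm_ptransf s : ptransf V := [ffun x => Some (s x)].

Definition merge_ptransf x y : ptransf V :=
  [ffun v => Some (if v == x then y else v)].

Definition remove_ptransf x : ptransf V :=
  [ffun v => if v == x then None else Some v].

Definition const_on (A : {set V}) y : ptransf V :=
  [ffun v => if v \in A then Some y else None].

Definition empty_ptransf : ptransf V := [ffun=> None].

Definition ptransf_dom a : {set V} := [set v | a v].

Lemma ptransf_mulE a b v : (a * b) v = obind b (a v).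
Proof. by rewrite ffunE. Qed.

Lemma ptransf_oneE v : (1 : ptransf V) v = Some v.
Proof. by rewrite ffunE. Qed.

Lemma perm_ptransfM : {morph perm_ptransf : s t / s * t}.
Proof.
by move=> s t; apply/ffunP=> v; rewrite ptransf_mulE !ffunE /= ffunE permM.
Qed.

Lemma perm_ptransf1 : perm_ptransf 1 = 1.
Proof. by apply/ffunP=> v; rewrite ptransf_oneE ffunE perm1. Qed.

(** Conjugation by permutations turns a single removal into all removals; [conj_merge] does the same
    for mergings. *)
Lemma conj_remove s x :
  perm_ptransf s * remove_ptransf (s x) * perm_ptransf s^-1 = remove_ptransf x.
Proof.
apply/ffunP=> v; rewrite !(ptransf_mulE, ffunE) /= !ffunE (inj_eq perm_inj).
by case: eqP => //= _; rewrite ffunE permK.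
Qed.

Lemma conj_merge s x y :
  perm_ptransf s * merge_ptransf (s x) (s y) * perm_ptransf s^-1 =
  merge_ptransf x y.
Proof.
apply/ffunP=> v; rewrite !(ptransf_mulE, ffunE) /= !ffunE /= (inj_eq perm_inj).
by rewrite ffunE; case: eqP => //= _; rewrite permK.
Qed.

Lemma mul_const_on a y :
  a * const_on [set: V] y = const_on (ptransf_dom a) y.
Proof.
apply/ffunP=> v; rewrite !(ptransf_mulE, ffunE) inE.
by case: (a v) => //= w; rewrite ffunE inE.
Qed.

Lemma const_on_mul A y a :
  const_on A y * a = if a y is Some y' then const_on A y' else empty_ptransf.
Proof.
apply/ffunP=> v; rewrite !(ptransf_mulE, ffunE).
by case: ifPn => vA; case ay: (a y) => [w|] /=;
  rewrite ?ffunE ?ay ?vA ?(negPf vA).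
Qed.

Lemma ptransf_dom_const_on A y : ptransf_dom (const_on A y) = A.
Proof. by apply/setP=> v; rewrite inE ffunE; case: (v \in A). Qed.

Lemma ptransf_dom0 a : ptransf_dom a = set0 -> a = empty_ptransf.
Proof.
move=> /setP a0; apply/ffunP=> v; move: (a0 v); rewrite !ffunE !inE.
by case: (a v).
Qed.

Lemma mul_empty_ptransf a : empty_ptransf * a = empty_ptransf.
Proof. by apply/ffunP=> v; rewrite !(ptransf_mulE, ffunE). Qed.

Lemma ptransf_mul_empty a : a * empty_ptransf = empty_ptransf.
Proof.
apply/ffunP=> v; rewrite !(ptransf_mulE, ffunE).
by case: (a v) => //= w; rewrite ffunE.
Qed.

Section Generation.
Variables (P : ptransf V -> Prop) (x1 x2 : V).
Hypotheses (x12 : x1 != x2) (PM : forall a b, P a -> P b -> P (a * b)).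
Hypotheses (Pperm : forall s, P (perm_ptransf s)).
Hypotheses (Premove : P (remove_ptransf x1)) (Pmerge : P (merge_ptransf x2 x1)).

Lemma all_remove x : P (remove_ptransf x).
Proof.
rewrite -(conj_remove (tperm x x1)) tpermL.
by apply: PM => //; apply: PM.
Qed.

Lemma all_merge x y : x != y -> P (merge_ptransf x y).
Proof.
(* The first factor brings [y] to [x1]; the second brings the image of [x] to [x2] and leaves [x1]
   alone, since neither of its two points is [x1]. *)
move=> xy; pose s := tperm y x1 * tperm (tperm y x1 x) x2.
have sx : s x = x2 by rewrite permM tpermL.
have sy : s y = x1.
  rewrite permM tpermL tpermD // 1?eq_sym //.
  by rewrite -{1}(tpermL y x1) (inj_eq perm_inj) eq_sym.
by rewrite -(conj_merge s) sx sy; apply: PM => //; apply: PM.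
Qed.

(* If the image of a misses the point m, redirect to m either a point outside
   the domain or one of two points with the same image: the result has a larger
   image, and a is its product with the removal of m, or with a merging of m. *)
Lemma ptransf_generation a : P a.
Proof.
pose im (b : ptransf V) := [set y | [exists x, b x == Some y]].
have im_le i m (b c : ptransf V) : (forall y, y \in im b -> y \in im c) ->
    m \notin im b -> c i = Some m -> #|~: im c| < #|~: im b|.
  move=> bc mb ci; apply: proper_card; rewrite properE !setCS.
  apply/andP; split; first exact/subsetP.
  apply/subsetPn; exists m => //.
  by rewrite inE; apply/existsP; exists i; rewrite ci.
have [k] := ubnP #|~: im a|; elim: k a => // k IHk a /ltnSE-le_k.
case: (pickP [pred m | m \notin im a]) => [m /= m_a|im_a]; last first.
  (* A surjective [a] undoes a choice [g] of preimages: [g] is injective, hence a permutation, and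
     [a] is its inverse. *)
  have pre y : exists x, a x == Some y.
    by apply/existsP; have /negbFE := im_a y; rewrite inE.
  pose g y := xchoose (pre y); have ag y : a (g y) = Some y.
    exact/eqP/(xchooseP (pre y)).
  have g_inj : injective g by move=> y y' gy; apply: Some_inj; rewrite -!ag gy.
  suff -> : a = perm_ptransf (perm g_inj)^-1 by exact: Pperm.
  apply/ffunP=> x; rewrite ffunE -{1}(permKV (perm g_inj) x) permE.
  exact: ag.
pose upd i : ptransf V := [ffun x => if x == i then Some m else a x].
have updi i : upd i i = Some m by rewrite ffunE eqxx.
have am x : a x != Some m.
  by apply: contra m_a => amx; rewrite inE; apply/existsP; exists x.
case: (pickP [pred i | a i == None]) => [i /eqP ai|a_full].
  have -> : a = upd i * remove_ptransf m.
    apply/ffunP=> x; rewrite ptransf_mulE !ffunE.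
    case: eqP => [->|_] /=; first by rewrite ffunE eqxx.
    move: (am x); case: (a x) => //= y; rewrite ffunE (inj_eq Some_inj).
    by move/negPf->.
  apply: PM (all_remove m); apply: IHk.
  apply: leq_trans le_k; apply: (im_le i m) => // y; rewrite !inE.
  move=> /existsP[x /eqP ax]; apply/existsP; exists x; rewrite ffunE.
  by case: (eqVneq x i) => [xi|_]; [rewrite -xi ax in ai | rewrite ax].
have ha x : {y | a x = Some y}.
  by move: (a_full x) => /=; case: (a x) => // y _; exists y.
pose h x := sval (ha x); have aE x : a x = Some (h x) by exact: svalP (ha x).
(* Here [a] is total and misses [m]; on a finite set it is then not injective. *)
have /injectivePn[i [j ij hij]] : ~~ injectiveb h.
  apply/injectiveP => h_inj; have [x mx] := codomP (injF_onto h_inj m).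
  by case/eqP: (am x); rewrite aE mx.
have hm x : h x != m by rewrite -(inj_eq Some_inj) -aE.
have -> : a = upd i * merge_ptransf m (h i).
  apply/ffunP=> x; rewrite ptransf_mulE !ffunE.
  case: eqP => [->|_] /=; first by rewrite ffunE eqxx aE.
  by rewrite aE /= ffunE (negPf (hm x)).
apply: PM (all_merge _); last by rewrite eq_sym.
apply: IHk; apply: leq_trans le_k; apply: (im_le i m) => // y; rewrite !inE.
move=> /existsP[x /eqP ax]; apply/existsP.
have [xi|xi] := eqVneq x i; last by exists x; rewrite ffunE (negPf xi) ax.
(* The value that [upd i] gives up at [i] is still taken at [j]. *)
by exists j; rewrite ffunE [j == i]eq_sym (negPf ij) aE -hij -xi -aE ax.
Qed.

End Generation.
End Transformations.

(** * Words for the transformations of the nonzero points *)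

(* The set {1, ..., n-1} is 'I_m.+2 with all labels shifted down by one. *)
Section NonzeroGenerators.
Variable m : nat.
Local Notation V := 'I_m.+2.

Definition gen1 (x : letter0) : ptransf V :=
  match x with
  | La0 => perm_ptransf (tperm ord0 (lift ord0 ord0))
  | Lb0 => perm_ptransf (perm (@ordS_inj m.+2))
  | Le0 => merge_ptransf (lift ord0 ord0) ord0
  | Lf0 => remove_ptransf ord0
  end.

Lemma gen1_generate a : exists u, eval_word gen1 u = a.
Proof.
have PM (b c : ptransf V) : (exists u, eval_word gen1 u = b) ->
    (exists u, eval_word gen1 u = c) -> exists u, eval_word gen1 u = b * c.
  by move=> [u <-] [v <-]; exists (u * v); rewrite eval_wordM.
have Pgen x : exists u, eval_word gen1 u = gen1 x.
  by exists (letter_word x); rewrite eval_letter.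
apply: (@ptransf_generation _ (fun b => exists u, eval_word gen1 u = b)
  ord0 (lift ord0 ord0)) => //; last 2 first.
- exact: (Pgen Lf0).
- exact: (Pgen Le0).
(* The permutations expressed by words are closed under products, which in a finite group is enough
   for a subgroup. *)
pose H := [set s : {perm V} | boolp.asbool
  (exists u, eval_word gen1 u = perm_ptransf s)].
have HP s : s \in H -> exists u, eval_word gen1 u = perm_ptransf s.
  by rewrite inE => /boolp.asboolP.
have PH s : (exists u, eval_word gen1 u = perm_ptransf s) -> s \in H.
  by move=> Ps; rewrite inE; apply/boolp.asboolP.
have gH : group_set H.
  apply/group_setP; split=> [|s t /HP Hs /HP Ht]; apply: PH.
    by exists 1; rewrite eval_word1 perm_ptransf1.
  by rewrite perm_ptransfM; exact: PM.
pose G := Group gH.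
have Ga : tperm ord0 (lift ord0 ord0) \in G by exact/PH/(Pgen La0).
have Gb : perm (@ordS_inj m.+2) \in G by exact/PH/(Pgen Lb0).
have ordSE k : k.+1 < m.+2 -> ordS (inord k : V) = inord k.+1.
  move=> lt_k; apply: val_inj => /=.
  by rewrite !inordK ?modn_small // ltnW.
have o0 : ord0 = inord 0 :> V by apply: val_inj; rewrite /= inordK.
have o1 : lift ord0 ord0 = inord 1 :> V by apply: val_inj; rewrite /= inordK.
(* Conjugation by the cycle carries each adjacent transposition to the next one. *)
have Gadj k : k.+1 < m.+2 -> tperm (inord k) (inord k.+1 : V) \in G.
  elim: k => [|k IHk] lt_k; first by rewrite -o0 -o1.
  have := groupJ (IHk (ltnW lt_k)) Gb.
  by rewrite tpermJ !permE !ordSE // ltnW.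
(* Conjugating (0 k) by (k k+1) gives (0 k+1); the transpositions moving 0 generate the symmetric
   group. *)
have Gstar k : k < m.+2 -> tperm ord0 (inord k : V) \in G.
  elim: k => [|k IHk] lt_k; first by rewrite -o0 tperm1 group1.
  have [->|k0] := posnP k; first by rewrite -o1.
  have := groupJ (IHk (ltnW lt_k)) (Gadj k lt_k).
  rewrite tpermJ tpermL tpermD // -val_eqE /= inordK // ?(ltnW lt_k) //.
  by rewrite -lt0n.
move=> s; apply: HP; suff: [set: {perm V}] \subset G.
  by move/subsetP; apply; rewrite inE.
rewrite -(gen_tperm ord0) gen_subG; apply/subsetP=> _ /imsetP[y _ ->].
by rewrite -(inord_val y); apply: Gstar.
Qed.

Lemma ordS_small (i : V) : i < m.+1 -> ordS i = i.+1 :> nat.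
Proof. by move=> lt_i; rewrite /= modn_small. Qed.

Lemma ordS_last (i : V) : m < i -> ordS i = ord0.
Proof.
move=> gt_i; apply: val_inj => /=.
suff -> : i = m.+1 :> nat by rewrite modnn.
by apply/eqP; rewrite eqn_leq gt_i -ltnS ltn_ord.
Qed.

(** The factor [g] drops 0 and moves every other point one step up, the last one back to 0. A point
    [i > 0] thus reaches 0 after [m + 2 - i] steps and disappears at the next one, so [m + 2]
    factors (that is, [n - 1]) remove everything. *)
Lemma gen1_empty : (gen1 Lf0 * gen1 Lb0) ^+ m.+2 = empty_ptransf V.
Proof.
set g := _ * _.
have g0 : g ord0 = None by rewrite ptransf_mulE ffunE eqxx.
have gS (i : V) : 0 < i -> g i = Some (ordS i).
  move=> i0; rewrite ptransf_mulE ffunE -val_eqE /= eqn0Ngt i0 /=.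
  by rewrite ffunE permE.
have gk k (i : V) : 0 < k -> m.+2 < i + k \/ i = ord0 -> (g ^+ k) i = None.
  elim: k i => // k IHk i _ ik; rewrite expgS ptransf_mulE.
  have [i0|i0] := posnP i.
    by rewrite (_ : i = ord0) ?g0 //; apply: val_inj.
  case: ik => [ik|i_0]; last by rewrite i_0 in i0.
  rewrite gS //=; have [lt_i|gt_i] := ltnP i m.+1.
    apply: IHk; last by left; rewrite ordS_small // addSnnS.
    move: ik; rewrite addnS ltnS => ik.
    by rewrite -(ltn_add2l i) addn0; apply: leq_trans ik; apply: leqW.
  rewrite ordS_last //; apply: IHk; last by right.
  move: ik; rewrite addnS ltnS => ik; rewrite -(ltn_add2l i) addn0.
  exact: leq_trans (ltn_ord i) _.
apply/ffunP=> i; rewrite [RHS]ffunE; apply: gk => //.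
have [i0|i0] := posnP i; [right; exact: val_inj | left].
by rewrite -[X in X < _]add0n ltn_add2r.
Qed.

(** The factor [g] sends 0 and 1 to 1 and moves every other point one step up, the last one back to
    0. A point [i > 1] enters {0, 1} after [m + 2 - i <= m] steps and stays there; the final [e]
    sends both to 0. *)
Lemma gen1_const :
  (gen1 Le0 * gen1 Lb0) ^+ m * gen1 Le0 = const_on [set: V] ord0.
Proof.
set g := gen1 Le0 * gen1 Lb0; set e := gen1 Le0.
have g1 (i : V) : i <= 1 -> g i = Some (lift ord0 ord0).
  move=> i1; rewrite ptransf_mulE ffunE /= -val_eqE /=.
  have -> : (if nat_of_ord i == bump 0 0 then ord0 else i) = ord0 :> V.
    by apply: val_inj; case: i i1 => [[|[]]].
  by rewrite ffunE permE; congr Some; apply: val_inj.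
have gS (i : V) : 1 < i -> g i = Some (ordS i).
  move=> i1; rewrite ptransf_mulE ffunE -val_eqE /= gtn_eqF //=.
  by rewrite ffunE permE.
have gk k (i : V) : i <= 1 \/ m.+1 < i + k -> (g ^+ k * e) i = Some ord0.
  elim: k i => [|k IHk] i ik.
    rewrite mul1g ffunE -val_eqE /=; congr Some; apply: val_inj => /=.
    case: ik => [|]; first by case: i => [[|[]]].
    by rewrite addn0 ltnNge -ltnS ltn_ord.
  rewrite expgS -mulgA ptransf_mulE.
  have [i1|i1] := leqP i 1; first by rewrite g1 //=; apply: IHk; left.
  case: ik => [|ik]; first by rewrite leqNgt i1.
  rewrite gS //=; apply: IHk; have [lt_i|gt_i] := ltnP i m.+1.
    by right; rewrite ordS_small // addSnnS.
  by left; rewrite ordS_last.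
apply/ffunP=> i; rewrite gk ?ffunE ?inE //.
have [|i1] := leqP i 1; [by left | right].
by rewrite -[X in X < _]add1n ltn_add2r.
Qed.
End NonzeroGenerators.

(** * Extension of transformations by the fixed point 0 *)

Section Lift.
Variable k : nat.
Implicit Type f : ptransf 'I_k.

Definition lift_ptransf f : ptransf 'I_k.+1 :=
  [ffun i => if unlift ord0 i is Some x then omap (lift ord0) (f x)
             else Some ord0].

Lemma lift_ptransf_ord0 f : lift_ptransf f ord0 = Some ord0.
Proof. by rewrite ffunE unlift_none. Qed.

Lemma lift_ptransf_lift f x :
  lift_ptransf f (lift ord0 x) = omap (lift ord0) (f x).
Proof. by rewrite ffunE liftK. Qed.

Lemma ptransf_eq_lift (a b : ptransf 'I_k.+1) :
  a ord0 = b ord0 -> (forall x, a (lift ord0 x) = b (lift ord0 x)) -> a = b.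
Proof.
by move=> ab0 ab; apply/ffunP=> i; case: (unliftP ord0 i) => [x|] ->.
Qed.

Lemma lift_ptransf_morph : monoid_morphism lift_ptransf.
Proof.
split=> [|f g]; apply: ptransf_eq_lift => [|x].
- by rewrite lift_ptransf_ord0 ptransf_oneE.
- by rewrite lift_ptransf_lift !ptransf_oneE.
- by rewrite ptransf_mulE !lift_ptransf_ord0 /= lift_ptransf_ord0.
rewrite ptransf_mulE !lift_ptransf_lift ptransf_mulE.
by case: (f x) => //= y; rewrite lift_ptransf_lift.
Qed.

End Lift.

(** * Products of d and z with the extended maps *)

Section Generators.

Lemma ptransf_ofE n (h : nat -> option nat) (i : 'I_n) (o : option 'I_n) :
  h i = omap val o -> ptransf_of n h i = o.
Proof. by move=> hi; rewrite ffunE hi; case: o {hi} => //= j; rewrite valK. Qed.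

Variable k : nat.
Local Notation n := k.+2.

Lemma tr_d_ord0 : tr_d n ord0 = None.
Proof. exact: ptransf_ofE. Qed.

Lemma tr_d_lift x : tr_d n (lift ord0 x) = Some (lift ord0 x).
Proof. exact: ptransf_ofE. Qed.

Lemma tr_z_ord0 : tr_z n ord0 = Some (lift ord0 ord0).
Proof. exact: ptransf_ofE. Qed.

Lemma tr_z_lift x : tr_z n (lift ord0 x) = Some ord0.
Proof. exact: ptransf_ofE. Qed.

Definition trE := (lift_ptransf_ord0, lift_ptransf_lift, tr_d_ord0, tr_d_lift,
  tr_z_ord0, tr_z_lift).

Implicit Type f : ptransf 'I_k.+1.

Lemma lift_d f : lift_ptransf f * tr_d n = tr_d n * lift_ptransf f.
Proof.
apply: ptransf_eq_lift => [|x]; rewrite !ptransf_mulE !trE /= !trE //.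
by case: (f x) => //= y; rewrite trE.
Qed.

(** All that z sees of a point is whether it is 0, and a total [f] changes neither this nor the
    domain. *)
Lemma lift_z f : (forall x, f x) -> lift_ptransf f * tr_z n = tr_z n.
Proof.
move=> ft.
apply: ptransf_eq_lift => [|x]; rewrite !ptransf_mulE !trE /= ?trE //.
by have := ft x; case: (f x) => //= y _; rewrite trE.
Qed.

Lemma tr_dd : tr_d n * tr_d n = tr_d n.
Proof.
by apply: ptransf_eq_lift => [|x]; rewrite !ptransf_mulE !trE /= ?trE.
Qed.

Lemma tr_dz : tr_d n * tr_z n = tr_z n * lift_ptransf (remove_ptransf ord0).
Proof.
by apply: ptransf_eq_lift => [|x];
  rewrite !ptransf_mulE !trE /= ?trE //= ?trE ?ffunE.
Qed.

(** Both sides have domain {0} and send 0 to 1. *)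
Lemma tr_zd : tr_z n * tr_d n = lift_ptransf (empty_ptransf _) * tr_z n.
Proof.
by apply: ptransf_eq_lift => [|x];
  rewrite !ptransf_mulE !trE /= ?trE //= ?trE ?ffunE.
Qed.

Lemma tr_zz : tr_z n * tr_z n = lift_ptransf (const_on [set: _] ord0).
Proof.
by apply: ptransf_eq_lift => [|x];
  rewrite !ptransf_mulE !trE /= ?trE //= ?trE ?ffunE inE.
Qed.

Lemma tr_d_empty_z :
  tr_d n * lift_ptransf (empty_ptransf _) * tr_z n =
  tr_d n * lift_ptransf (empty_ptransf _).
Proof.
by apply: ptransf_eq_lift => [|x];
  rewrite !ptransf_mulE !trE /= ?trE //= ?trE ?ffunE.
Qed.

End Generators.

Lemma generator0E m x : generator0 m.+3 x = lift_ptransf (gen1 m x).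
Proof.
case: x => /=; apply: ptransf_eq_lift => [|x]; rewrite !trE;
  apply: ptransf_ofE => //=; rewrite ffunE.
- by rewrite permE /= -!val_eqE /=; case: x => [[|[|x]]].
- rewrite permE /=; have [lt_x|gt_x] := ltnP x m.+1.
    by rewrite /= /bump /= !add1n eqSS ltn_eqF // modn_small.
  (* At the last point the cyclic successor wraps around to the label 1. *)
  have -> : x = m.+1 :> nat by apply/eqP; rewrite eqn_leq gt_x -ltnS ltn_ord.
  by rewrite modnn /bump /= add1n eqxx.
- by rewrite -val_eqE /= /bump /= !add1n; case: x => [[|[|x]]].
- by rewrite -val_eqE /= /bump /= !add1n; case: x => [[|x]].
Qed.

(** * Partial strong endomorphisms of the star *)

Section StarPsEnd.
Variable k : nat.
Local Notation n := k.+2.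

Lemma star_edgeE (u v : 'I_n) :
  ([set u; v] \in edges (star n)) = ((u == ord0) != (v == ord0)).
Proof.
apply/imset2P/idP => [[i j]|].
  rewrite !inE => /eqP i0 j0 uv.
  have {}i0 : i = ord0 by exact: val_inj.
  have {}j0 : j != ord0 by rewrite -val_eqE /= -lt0n.
  have : i \in [set u; v] by rewrite uv set21.
  have : j \in [set u; v] by rewrite uv set22.
  rewrite !inE => /pred2P[] ju /pred2P[] iu; move: j0 i0; rewrite ju iu.
  - by move=> /eqP.
  - by move=> /negPf-> ->; rewrite eqxx.
  - by move=> /negPf-> ->; rewrite eqxx.
  - by move=> /eqP.
have gt0 (w : 'I_n) : w != ord0 -> 0 < w by rewrite -val_eqE /= -lt0n.
case: (eqVneq u ord0) (eqVneq v ord0) => [u0|u0] [v0|v0] // _.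
  by exists u v; rewrite ?inE ?u0 ?gt0.
by exists v u; rewrite ?inE ?v0 ?gt0 // setUC.
Qed.

(** The star is complete bipartite with sides {0} and the rest. Adjacency means lying on different
    sides, so a partial strong endomorphism is a partial map that preserves and reflects the
    same-side relation. *)
Lemma is_psend_starP (a : ptransf 'I_n) :
  reflect (forall u v u' v', a u = Some u' -> a v = Some v' ->
             ((u == ord0) == (v == ord0)) = ((u' == ord0) == (v' == ord0)))
          (is_psend (star n) a).
Proof.
apply: (iffP forallP) => [aP u v u' v' au av|aP u].
  have := forallP (aP u) v; rewrite au av !star_edgeE => /eqP.
  by move/(congr1 negb); rewrite !negbK.
apply/forallP=> v; case au: (a u) => [u'|//]; case av: (a v) => [v'|//].
by rewrite !star_edgeE (aP _ _ _ _ au av).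
Qed.

Lemma lift_psend f : is_psend (star n) (lift_ptransf f).
Proof.
apply/is_psend_starP => u v u' v'.
suff fP w w' : lift_ptransf f w = Some w' -> (w == ord0) = (w' == ord0).
  by move=> /fP -> /fP ->.
case: (unliftP ord0 w) => [x|] ->; rewrite !trE; last by case=> <-.
by case: (f x) => //= y [<-].
Qed.

Lemma d_psend : is_psend (star n) (tr_d n).
Proof.
apply/is_psend_starP => u v u' v'.
suff dP w w' : tr_d n w = Some w' -> (w == ord0) = (w' == ord0).
  by move=> /dP -> /dP ->.
by case: (unliftP ord0 w) => [x|] ->; rewrite !trE // => -[<-].
Qed.

(** Whereas d and the extended maps keep each point on its side, z exchanges the sides, which also
    respects the same-side relation. *)
Lemma z_psend : is_psend (star n) (tr_z n).
Proof.
apply/is_psend_starP => u v u' v'.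
suff zP w w' : tr_z n w = Some w' -> (w == ord0) = (w' != ord0).
  by move=> /zP -> /zP ->; case: (u' == ord0); case: (v' == ord0).
by case: (unliftP ord0 w) => [x|] ->; rewrite !trE // => -[<-].
Qed.

End StarPsEnd.

Lemma generator_psend m x : is_psend (star m.+3) (generator m.+3 x).
Proof.
case: x => [x||]; [|exact: d_psend|exact: z_psend].
by rewrite /= generator0E; exact: lift_psend.
Qed.

(** * Normal forms in a monoid [Q] with an evaluation map [E] *)

Section NormalForms.
Variables (k : nat) (Q : monoidType).
Local Notation V := 'I_k.+1.
Variables (iota : ptransf V -> Q) (D Z : Q) (E : Q -> ptransf 'I_k.+2).
Local Notation c := (const_on [set: V] ord0).
Local Notation none := (empty_ptransf V).

Hypothesis iota_morph : monoid_morphism iota.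
Hypotheses (DD : D * D = D) (iotaD : forall f, iota f * D = D * iota f).
Hypotheses (cZ : iota c * Z = Z) (DZ : D * Z = Z * iota (remove_ptransf ord0)).
Hypotheses (ZD : Z * D = iota none * Z) (ZZ : Z * Z = iota c).
Hypothesis DnoneZ : D * iota none * Z = D * iota none.
Hypotheses (E_morph : monoid_morphism E).
Hypothesis Eiota : forall f, E (iota f) = lift_ptransf f.
Hypotheses (ED : E D = tr_d k.+2) (EZ : E Z = tr_z k.+2).
Hypothesis Q_ind : forall P : Q -> Prop, P 1 ->
  (forall q f, P q -> P (q * iota f)) -> (forall q, P q -> P (q * D)) ->
  (forall q, P q -> P (q * Z)) -> forall q, P q.

Let iotaM f g : iota f * iota g = iota (f * g).
Proof. by rewrite iota_morph.2. Qed.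

Let EM : {morph E : p q / p * q}.
Proof. exact: E_morph.2. Qed.

(** Associativity gives Z Z^2 = Z^2 Z, where Z^2 is [iota c], absorbed by Z on its right. *)
Lemma Z_c : Z * iota c = Z.
Proof. by rewrite -ZZ mulgA ZZ. Qed.

(** First, none = Z D Z. Writing r for the removal of [ord0], the chain is Z none = Z r none = D Z
    none = D Z Z D Z = D c D Z = D D c Z = D Z. *)
Lemma Z_none : Z * iota none = D * Z.
Proof.
have ZDZ : Z * D * Z = iota none.
  by rewrite ZD -mulgA ZZ iotaM mul_empty_ptransf.
have remove_none : remove_ptransf ord0 * none = none :> ptransf V.
  exact: ptransf_mul_empty.
rewrite -remove_none -iotaM mulgA -DZ -ZDZ.
by rewrite -!mulgA (mulgA Z Z) ZZ (mulgA (iota c)) iotaD -mulgA cZ mulgA DD.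
Qed.

(** Insert [c] between Z and [f]: the product [c * f] is constant with value [f ord0], or empty. *)
Lemma Z_iota f : Z * iota f =
  if f ord0 is Some y then Z * iota (const_on [set: V] y) else D * Z.
Proof.
rewrite -{1}Z_c -mulgA iotaM const_on_mul.
by case: (f ord0) => // ; exact: Z_none.
Qed.

Lemma iota_Z f : iota f * Z = iota (const_on (ptransf_dom f) ord0) * Z.
Proof. by rewrite -mul_const_on -iotaM -mulgA cZ. Qed.

Definition ptransf_low (a : ptransf 'I_k.+2) : ptransf V :=
  [ffun x => obind (unlift ord0) (a (lift ord0 x))].

Definition zero_fiber (a : ptransf 'I_k.+2) : {set V} :=
  [set x | a (lift ord0 x) == Some ord0].

(** The empty map is both of the form D iota(f) and of the form D iota(f) Z. The test on
    [zero_fiber] settles on the first, and [DnoneZ] reconciles the two. *)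
Definition normal_form (a : ptransf 'I_k.+2) : Q :=
  if a ord0 is Some j then
    if unlift ord0 j is Some y then
      iota (const_on (zero_fiber a) ord0) * Z * iota (const_on [set: V] y)
    else iota (ptransf_low a)
  else if zero_fiber a == set0 then D * iota (ptransf_low a)
  else D * iota (const_on (zero_fiber a) ord0) * Z.

Lemma ptransf_low_lift (a : ptransf _) (f : ptransf V) :
  (forall x, a (lift ord0 x) = omap (lift ord0) (f x)) -> ptransf_low a = f.
Proof.
move=> af; apply/ffunP=> x; rewrite ffunE af.
by case: (f x) => //= y; rewrite liftK.
Qed.

Lemma zero_fiber_lift (a : ptransf 'I_k.+2) (f : ptransf V) :
  (forall x, a (lift ord0 x) = omap (lift ord0) (f x)) -> zero_fiber a = set0.
Proof. by move=> af; apply/setP=> x; rewrite !inE af; case: (f x). Qed.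

Lemma zero_fiber_dom (a : ptransf 'I_k.+2) (f : ptransf V) :
  (forall x, a (lift ord0 x) = omap (fun=> ord0) (f x)) ->
  zero_fiber a = ptransf_dom f.
Proof.
move=> af; apply/setP=> x; rewrite !inE af.
by case: (f x) => //= y; rewrite eqxx.
Qed.

Lemma normal_form_iota f : normal_form (E (iota f)) = iota f.
Proof.
rewrite /normal_form Eiota lift_ptransf_ord0 unlift_none.
by rewrite (@ptransf_low_lift _ f) // => x; rewrite lift_ptransf_lift.
Qed.

Lemma normal_form_Diota f : normal_form (E (D * iota f)) = D * iota f.
Proof.
set a := E _.
have aE : a = tr_d k.+2 * lift_ptransf f by rewrite /a EM ED Eiota.
have a0 : a ord0 = None by rewrite aE ptransf_mulE !trE.
have af x : a (lift ord0 x) = omap (lift ord0) (f x).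
  by rewrite aE ptransf_mulE !trE /= !trE.
by rewrite /normal_form a0 (zero_fiber_lift af) eqxx (ptransf_low_lift af).
Qed.

Lemma normal_form_DiotaZ f : normal_form (E (D * iota f * Z)) = D * iota f * Z.
Proof.
set a := E _.
have aE : a = tr_d k.+2 * lift_ptransf f * tr_z k.+2.
  by rewrite /a !EM ED Eiota EZ.
have a0 : a ord0 = None by rewrite aE !ptransf_mulE !trE.
have af x : a (lift ord0 x) = omap (fun=> ord0) (f x).
  by rewrite aE !ptransf_mulE !trE /= !trE; case: (f x) => //= y; rewrite trE.
rewrite /normal_form a0 (zero_fiber_dom af).
have [f0|_] := eqVneq; last by rewrite -!mulgA -iota_Z.
rewrite (ptransf_dom0 f0) DnoneZ (@ptransf_low_lift _ none) // => x.
by rewrite af (ptransf_dom0 f0) ffunE.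
Qed.

Lemma normal_form_iotaZ f y :
  normal_form (E (iota f * Z * iota (const_on [set: V] y))) =
  iota f * Z * iota (const_on [set: V] y).
Proof.
set a := E _.
have aE : a = lift_ptransf f * tr_z k.+2 * lift_ptransf (const_on [set: V] y).
  by rewrite /a !EM !Eiota EZ.
have a0 : a ord0 = Some (lift ord0 y).
  by rewrite aE !ptransf_mulE !trE /= !trE /= !trE ffunE inE.
have af x : a (lift ord0 x) = omap (fun=> ord0) (f x).
  by rewrite aE !ptransf_mulE !trE; case: (f x) => //= z; rewrite trE /= trE.
by rewrite /normal_form a0 liftK (zero_fiber_dom af) -iota_Z.
Qed.

(** This makes evaluation injective. Any element recovered by [normal_form] has one of the four
    shapes, and right multiplication of a shape by [iota f], D or Z gives a recovered element again;
    induction then reaches all of [Q]. *)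
Lemma normal_formK q : normal_form (E q) = q.
Proof.
pose N q := normal_form (E q) = q.
have N_iotaZiota f g : N (iota f * Z * iota g).
  rewrite /N -mulgA Z_iota; case: (g ord0) => [y|].
    by rewrite mulgA normal_form_iotaZ.
  by rewrite mulgA iotaD normal_form_DiotaZ.
(* D Z equals Z followed by the removal of [ord0]; any further [g] leaves [ord0] undefined, so
   [Z_iota] returns D Z. *)
have DZ_iota g : D * Z * iota g = D * Z.
  by rewrite {1}DZ -mulgA iotaM Z_iota ptransf_mulE ffunE eqxx.
have N_cases q0 : N q0 -> [\/ exists f, q0 = iota f, exists f, q0 = D * iota f,
    exists f y, q0 = iota f * Z * iota (const_on [set: V] y) |
    exists f, q0 = D * iota f * Z].
  move=> <-; rewrite /normal_form; case: (E q0 ord0) => [j|].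
    case: (unlift ord0 j) => [y|]; last by apply: Or41; eexists.
    by apply: Or43; do 2 eexists.
  case: ifP => _; first by apply: Or42; eexists.
  by apply: Or44; eexists.
have N_iota f : N (iota f) by exact: normal_form_iota.
have N_D f : N (D * iota f) by exact: normal_form_Diota.
have N_DZ f : N (D * iota f * Z) by exact: normal_form_DiotaZ.
have DiotaZ_iota f g : D * iota f * Z * iota g = D * iota f * Z.
  by rewrite -iotaD -(mulgA _ D Z) -mulgA DZ_iota.
have DD_iota f : D * (D * f) = D * f by rewrite mulgA DD.
have iota_Z_iota_Z f y :
    iota f * Z * iota (const_on [set: V] y) * Z = iota (f * c).
  by rewrite -!mulgA iota_Z ptransf_dom_const_on cZ ZZ iotaM.
elim/Q_ind: q => [|q f /N_cases|q /N_cases|q /N_cases].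
- by rewrite -iota_morph.1; exact: N_iota.
- case=> [[g ->]|[g ->]|[g [y ->]]|[g ->]].
  + by rewrite iotaM; exact: N_iota.
  + by rewrite -mulgA iotaM; exact: N_D.
  + by rewrite -mulgA iotaM; exact: N_iotaZiota.
  + by rewrite DiotaZ_iota; exact: N_DZ.
- case=> [[g ->]|[g ->]|[g [y ->]]|[g ->]].
  + by rewrite iotaD; exact: N_D.
  + by rewrite -mulgA iotaD DD_iota; exact: N_D.
  (* D moves left past the constant and meets Z, where Z D = none Z. *)
  + rewrite -mulgA iotaD -(mulgA _ Z) (mulgA Z) ZD !mulgA iotaM.
    exact: N_iotaZiota.
  + rewrite -mulgA ZD mulgA -(mulgA D) iotaM; exact: N_DZ.
- case=> [[g ->]|[g ->]|[g [y ->]]|[g ->]].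
  + by have := N_iotaZiota g 1; rewrite iota_morph.1 mulg1.
  + exact: N_DZ.
  + by rewrite iota_Z_iota_Z; exact: N_iota.
  + by rewrite -mulgA ZZ -mulgA iotaM; exact: N_D.
Qed.

(** This makes evaluation surjective. One value fixes the behaviour on sides: if 0 goes to a nonzero
    point, all other points of the domain go to 0; if 0 goes to 0, no other point does; if 0 is
    undefined, one nonzero point sent to 0 forces all of them there. *)
Lemma normal_formP a : is_psend (star k.+2) a -> E (normal_form a) = a.
Proof.
move=> /is_psend_starP aP; rewrite /normal_form.
have liftF (x : V) : (lift ord0 x == ord0) = false by [].
have low x : a (lift ord0 x) != Some ord0 ->
    omap (lift ord0) (ptransf_low a x) = a (lift ord0 x).
  by rewrite ffunE; case: (a _) => //= w; case: (unliftP ord0 w) => [y|] ->.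
have fib x : (forall w, a (lift ord0 x) = Some w -> w = ord0) ->
    omap (fun=> ord0) (const_on (zero_fiber a) (ord0 : V) x) = a (lift ord0 x).
  rewrite ffunE inE; case: (a _) => // w /(_ _ erefl) ->; by rewrite eqxx.
case a0: (a ord0) => [j|].
  case: (unliftP ord0 j) => [y|] jE; rewrite jE {j jE} in a0.
    have aw x w : a (lift ord0 x) = Some w -> w = ord0.
      by move=> /(aP _ _ _ _ a0) /=; rewrite eqxx !liftF; case: (w =P ord0).
    rewrite !EM !Eiota EZ; apply: ptransf_eq_lift => [|x].
      by rewrite !ptransf_mulE !trE /= !trE /= !trE a0 ffunE inE.
    rewrite !ptransf_mulE !trE -(fib x (aw x)).
    by case: (const_on _ _ _) => //= z; rewrite trE /= trE.
  rewrite Eiota; apply: ptransf_eq_lift => [|x]; rewrite !trE ?a0 // low //.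
  by apply/eqP=> /(aP _ _ _ _ a0).
case: eqP => [fib0|/eqP/set0Pn[x0]].
  rewrite EM ED Eiota; apply: ptransf_eq_lift => [|x].
    by rewrite ptransf_mulE trE a0.
  rewrite ptransf_mulE trE /= trE low //.
  by have /setP/(_ x) := fib0; rewrite !inE => ->.
rewrite inE => /eqP ax0.
have aw x w : a (lift ord0 x) = Some w -> w = ord0.
  by move=> /(aP _ _ _ _ ax0) /=; rewrite eqxx !liftF; case: (w =P ord0).
rewrite !EM ED EZ Eiota; apply: ptransf_eq_lift => [|x].
  by rewrite !ptransf_mulE trE a0.
rewrite !ptransf_mulE trE /= trE -(fib x (aw x)).
by case: (const_on _ _ _) => //= z; rewrite trE.
Qed.

End NormalForms.

(** * The monoid presented by R_s and the conclusion *)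

Section Presentation.
Variables (m : nat) (R0 : word letter0 -> word letter0 -> Prop).
Local Notation n := m.+3.
Local Notation V := 'I_m.+2.
Hypothesis R0P : forall u v : word letter0, congruent R0 u v <->
  eval_word (generator0 n) u = eval_word (generator0 n) v.

Local Notation Q := (presented (Rs n R0)).
Local Notation cls := (word_class (Rs n R0)).
Local Notation cls0 u := (cls (map_word L0 u)).
Local Notation clx x := (cls (letter_word x)).

Lemma eval_generator0 u :
  eval_word (generator0 n) u = lift_ptransf (eval_word (gen1 m) u).
Proof.
apply/esym/eval_word_morph=> [|x]; first exact: lift_ptransf_morph.
by rewrite generator0E.
Qed.

Lemma Rs_sound u v : Rs n R0 u v ->
  eval_word (generator n) u = eval_word (generator n) v.
Proof.
have gen_total x : x \in [:: gen1 m La0; gen1 m Lb0; gen1 m Le0] ->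
    lift_ptransf x * tr_z n = tr_z n.
  rewrite !inE => /or3P[]/eqP-> ; apply: lift_z => y; by rewrite ffunE.
have liftM := (lift_ptransf_morph m.+2).2.
have liftX f k : lift_ptransf f ^+ k = lift_ptransf (f ^+ k) :> ptransf 'I_n.
  elim: k => [|k IHk]; first by rewrite (lift_ptransf_morph m.+2).1.
  by rewrite !expgS IHk liftM.
have kill : (lift_ptransf (gen1 m Lf0) * lift_ptransf (gen1 m Lb0)) ^+ (n - 1) =
    lift_ptransf (empty_ptransf V).
  by rewrite -liftM liftX subn1 gen1_empty.
have gE x : generator n (L0 x) = lift_ptransf (gen1 m x) by exact: generator0E.
have [dE zE] : generator n Ld = tr_d n /\ generator n Lz = tr_z n by [].
case=> {u v} [u v uv||||||||||||];
  rewrite ?(eval_wordM, eval_wordX, eval_letter, gE, dE, zE) ?lift_d //.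
- by rewrite !eval_word_map; apply/R0P; constructor.
- exact: tr_dd.
- by rewrite gen_total // !inE eqxx.
- by rewrite gen_total // !inE eqxx ?orbT.
- by rewrite gen_total // !inE eqxx ?orbT.
- exact: tr_dz.
- by rewrite kill tr_zd.
- rewrite -liftM liftX -liftM subSS subSS subSS subn0.
  by rewrite gen1_const -tr_zz.
- by rewrite kill tr_d_empty_z.
Qed.

(** Equal transformations give words congruent modulo R_0, and a derivation from R_0 stays one from
    R_s after embedding the alphabet. *)
Lemma cls0_eq u v :
  eval_word (gen1 m) u = eval_word (gen1 m) v -> cls0 u = cls0 v.
Proof.
move=> uv; apply/word_classP.
have: congruent R0 u v by apply/R0P; rewrite !eval_generator0 uv.
elim=> {u v uv} [u v uv|u|u v _|u v w _ uv _|u u' v v' _ uu' _ vv'].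
- exact/congruent_rel/Rs_R0.
- exact: congruent_refl.
- exact: congruent_sym.
- exact: congruent_trans.
- by rewrite /map_word !map_cat; exact: congruent_mul uu' vv'.
Qed.

Definition gen1_word (a : ptransf V) : word letter0 :=
  sval (boolp.cid (gen1_generate a)).

Lemma gen1_wordK a : eval_word (gen1 m) (gen1_word a) = a.
Proof. exact: svalP (boolp.cid (gen1_generate a)). Qed.

Definition tr_class (a : ptransf V) : Q := cls0 (gen1_word a).

(** The class does not depend on the word chosen by [gen1_word]; the morphism property follows from
    this. *)
Lemma tr_class_eval u : tr_class (eval_word (gen1 m) u) = cls0 u.
Proof. by apply: cls0_eq; rewrite gen1_wordK. Qed.

Lemma clsM u v : cls (u * v) = cls u * cls v.
Proof. exact: word_classM. Qed.

Lemma cls0M u v : cls0 (u * v) = cls0 u * cls0 v.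
Proof. by rewrite -clsM /map_word map_cat. Qed.

Lemma tr_class_gen x : tr_class (gen1 m x) = clx (L0 x).
Proof. by rewrite -(eval_letter (gen1 m)) tr_class_eval. Qed.

Lemma tr_class_morph : monoid_morphism tr_class.
Proof.
split=> [|a b]; first by rewrite -(eval_word1 (gen1 m)) tr_class_eval.
by rewrite -{1}(gen1_wordK a) -{1}(gen1_wordK b) -eval_wordM tr_class_eval cls0M.
Qed.

Lemma tr_classX a k : tr_class (a ^+ k) = tr_class a ^+ k.
Proof.
by elim: k => [|k IHk]; rewrite ?tr_class_morph.1 // !expgS tr_class_morph.2 IHk.
Qed.

Lemma cls_rel u v : Rs n R0 u v -> cls u = cls v.
Proof. by move=> uv; apply/word_classP; constructor. Qed.

Lemma tr_class_comm_d a : tr_class a * clx Ld = clx Ld * tr_class a.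
Proof.
rewrite -(gen1_wordK a) tr_class_eval.
elim: (gen1_word a) => [|x u IHu]; first by rewrite -!clsM mulg1 mul1g.
rewrite (cls0M (letter_word x) u) -mulgA IHu !mulgA; congr (_ * _).
by rewrite -!clsM; case: x; apply: cls_rel; constructor.
Qed.

Lemma tr_class_kill : tr_class (empty_ptransf V) =
  cls ((letter_word (L0 Lf0) * letter_word (L0 Lb0)) ^+ (n - 1)).
Proof.
rewrite -gen1_empty tr_classX tr_class_morph.2 !tr_class_gen.
by rewrite -clsM -word_classX subn1.
Qed.

Lemma tr_class_const : tr_class (const_on [set: V] ord0) = clx Lz * clx Lz.
Proof.
rewrite -clsM -expg2 (cls_rel (Rs_zz _ _)) -gen1_const tr_class_morph.2 tr_classX.
by rewrite tr_class_morph.2 !tr_class_gen -clsM -word_classX -clsM !subSS subn0.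
Qed.

(** The constant is a word in e_0 and b_0 alone, and z absorbs both letters on its left. *)
Lemma tr_class_const_z : tr_class (const_on [set: V] ord0) * clx Lz = clx Lz.
Proof.
rewrite -gen1_const tr_class_morph.2 tr_classX tr_class_morph.2.
rewrite !tr_class_gen -mulgA.
have ez : clx (L0 Le0) * clx Lz = clx Lz.
  by rewrite -clsM (cls_rel (Rs_e0z _ _)).
have bz : clx (L0 Lb0) * clx Lz = clx Lz.
  by rewrite -clsM (cls_rel (Rs_b0z _ _)).
rewrite ez.
suff: forall k, (clx (L0 Le0) * clx (L0 Lb0)) ^+ k * clx Lz = clx Lz by exact.
elim => [|k IHk]; first by rewrite mul1g.
by rewrite expgSr -!mulgA bz ez.
Qed.

Lemma star_presentation : exists g : letter -> psEnd (star n),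
  (forall x, psend_val (g x) = generator n x) /\
  presentation_defines (Rs n R0) g.
Proof.
pose g x : psEnd (star n) := PsEnd (generator_psend m x).
exists g; split=> //.
have val_morph : monoid_morphism (@psend_val _ (star n)) by [].
have gR u v : Rs n R0 u v -> eval_word g u = eval_word g v.
  move=> /Rs_sound uv; apply: val_inj.
  by rewrite /= !(eval_word_morph val_morph (h := generator n)).
have [f [f_morph fE]] := presented_lift gR.
have fx x : f (clx x) = g x by rewrite fE eval_letter.
exists f; split=> //.
(* Following [f] by the inclusion into all partial transformations puts its values where
   [normal_form] is defined. *)
pose E q := psend_val (f q).
have E_morph : monoid_morphism E.
  by split=> [|p q]; rewrite /E ?f_morph.1 ?f_morph.2.
have Eclass a : E (tr_class a) = lift_ptransf a.
  rewrite /E fE (eval_word_morph val_morph (h := generator n)) //.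
  by rewrite eval_word_map -[in RHS](gen1_wordK a) -eval_generator0.
have DD : clx Ld * clx Ld = clx Ld.
  by rewrite -clsM; apply: cls_rel; constructor.
have DZ : clx Ld * clx Lz = clx Lz * tr_class (remove_ptransf ord0).
  rewrite (tr_class_gen Lf0) -!clsM; apply: cls_rel; constructor.
have ZD : clx Lz * clx Ld = tr_class (empty_ptransf V) * clx Lz.
  by rewrite tr_class_kill -!clsM; apply: cls_rel; constructor.
have DnoneZ : clx Ld * tr_class (empty_ptransf V) * clx Lz =
    clx Ld * tr_class (empty_ptransf V).
  by rewrite tr_class_kill -!clsM; apply: cls_rel; constructor.
have Q_ind (P : Q -> Prop) : P 1 ->
    (forall q a, P q -> P (q * tr_class a)) ->
    (forall q, P q -> P (q * clx Ld)) ->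
    (forall q, P q -> P (q * clx Lz)) -> forall q, P q.
  move=> P1 Pi Pd Pz; apply: presented_ind => // q [x||]; last 2 first.
  - exact: Pd.
  - exact: Pz.
  by rewrite -tr_class_gen; exact: Pi.
have ED : E (clx Ld) = tr_d n by rewrite /E fx.
have EZ : E (clx Lz) = tr_z n by rewrite /E fx.
have EK := normal_formK tr_class_morph DD tr_class_comm_d tr_class_const_z
  DZ ZD (esym tr_class_const) DnoneZ E_morph Eclass
  ED EZ Q_ind.
exists (fun a => normal_form tr_class (clx Ld) (clx Lz) (psend_val a)) => [q|a].
  exact: EK.
by apply: val_inj; apply: (normal_formP E_morph Eclass ED EZ); exact: valP.
Qed.

End Presentation.

Theorem theorem3p4 (n : nat) (hn : 3 <= n)
    (R0 : word letter0 -> word letter0 -> Prop)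
    (hR0 : forall u v : word letter0,
       congruent R0 u v <->
       eval_word (generator0 n) u = eval_word (generator0 n) v) :
  exists g : letter -> psEnd (star n),
    (forall x : letter, psend_val (g x) = generator n x) /\
    presentation_defines (Rs n R0) g.
Proof.
by case: n hn hR0 => [|[|[|m]]] // _ R0P; exact: star_presentation.
Qed.
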